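(* Let $G_0=\{M\in\mathsf{GL}(2,\mathbb{R}) : \det M>0\}$ be the connected component of the identity of the Lie group $\mathsf{GL}(2,\mathbb{R})$. Then every left-invariant (respectively, every right-invariant) semi-Riemannian metric on $G_0$, of any signature, is not flat.
   Context: A semi-Riemannian metric on a manifold is a smooth symmetric $(0,2)$-tensor field that is nondegenerate at every point and has constant index. A metric on a Lie group is left-invariant (right-invariant) if all left (right) translations are isometries. A semi-Riemannian metric is flat if the curvature tensor of its Levi-Civita connection vanishes identically. *)

(* Defs.v *)
From HB Require Import structures.
From mathcomp Require Import all_boot all_order all_algebra.
From mathcomp Require Import all_classical all_reals all_analysis.
Set Implicit Arguments.
Unset Strict Implicit.
Unset Printing Implicit Defensive.
Import Order.TTheory GRing.Theory Num.Theory.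
Import numFieldNormedType.Exports.
Local Open Scope classical_set_scope.
Local Open Scope ring_scope.

(* The manifolds considered are the open subsets U of the space of real 2 x 2
   matrices, with the inclusion as a global chart: every tangent space T_p U is
   identified with 'M[R]_2.  Functions, vector fields and tensor fields on U are
   represented by total functions on 'M[R]_2, of which only the values on U
   matter. *)

Section Smooth.
Context {R : realType} {V W : normedModType R}.

Fixpoint differentiable_upto (k : nat) (U : set V) (f : V -> W) : Prop :=
  if k is k'.+1 then
    (forall p, U p -> differentiable f p) /\
    (forall v, differentiable_upto k' U (fun p => 'D_v f p))
  else True.

Definition smooth (U : set V) (f : V -> W) : Prop :=
  forall k, differentiable_upto k U f.

End Smooth.

Section SemiRiemannian.
Context {R : realType}.
Local Notation V := 'M[R]_2.

Definition vector_field := V -> V.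
(* g p X Y is the value at the point p on the tangent vectors X, Y. *)
Definition tensor02 := V -> V -> V -> R.

Implicit Types (U : set V) (g : tensor02) (X Y Z : vector_field).

Definition bilinear_form (b : V -> V -> R) : Prop :=
  (forall a x x' y, b (a *: x + x') y = a * b x y + b x' y) /\
  (forall a x y y', b x (a *: y + y') = a * b x y + b x y').

Definition symmetric_form (b : V -> V -> R) : Prop :=
  forall x y, b x y = b y x.

Definition nondegenerate_form (b : V -> V -> R) : Prop :=
  forall x, (forall y, b x y = 0) -> x = 0.

Definition negative_definite_on (b : V -> V -> R) (W : {vspace V}) : Prop :=
  forall x, x \in W -> x != 0 -> b x x < 0.

Definition has_index (b : V -> V -> R) (k : nat) : Prop :=
  (exists2 W : {vspace V}, \dim W = k & negative_definite_on b W) /\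
  (forall W : {vspace V}, negative_definite_on b W -> (\dim W <= k)%N).

(* As U has a global chart, a (0,2)-tensor field is smooth if and only if its
   values on constant vector fields are smooth. *)
Definition semi_riemannian_metric U g : Prop :=
  [/\ forall p, U p -> bilinear_form (g p),
      forall x y : V, smooth U (fun p => g p x y : R^o),
      forall p, U p -> symmetric_form (g p),
      forall p, U p -> nondegenerate_form (g p) &
      exists k, forall p, U p -> has_index (g p) k].

Definition diffeomorphism_of U (f : V -> V) : Prop :=
  exists f' : V -> V,
    [/\ smooth U f, smooth U f',
        forall p, U p -> U (f p), forall p, U p -> U (f' p) &
        forall p, U p -> f' (f p) = p /\ f (f' p) = p].

Definition pullback (f : V -> V) g : tensor02 :=
  fun p x y => g (f p) ('d f p x) ('d f p y).

Definition isometry_of U g (f : V -> V) : Prop :=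
  diffeomorphism_of U f /\
  forall p, U p -> forall x y, pullback f g p x y = g p x y.

Definition lie_bracket X Y : vector_field :=
  fun p => 'D_(X p) Y p - 'D_(Y p) X p.

(* Besides the usual axioms, [locality] says that nabla only depends on the
   restrictions to U of the total functions representing the fields. *)
Record affine_connection U
    (nabla : vector_field -> vector_field -> vector_field) : Prop := {
  connection_smooth : forall X Y,
    smooth U X -> smooth U Y -> smooth U (nabla X Y);
  connection_locality : forall X X' Y Y',
    smooth U X -> smooth U X' -> smooth U Y -> smooth U Y' ->
    (forall p, U p -> X p = X' p) -> (forall p, U p -> Y p = Y' p) ->
    forall p, U p -> nabla X Y p = nabla X' Y' p;
  connection_addl : forall X X' Y,
    smooth U X -> smooth U X' -> smooth U Y ->
    forall p, U p ->
    nabla (fun q => X q + X' q) Y p = nabla X Y p + nabla X' Y p;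
  connection_scalel : forall (f : V -> R^o) X Y,
    smooth U f -> smooth U X -> smooth U Y ->
    forall p, U p -> nabla (fun q => f q *: X q) Y p = f p *: nabla X Y p;
  connection_addr : forall X Y Y',
    smooth U X -> smooth U Y -> smooth U Y' ->
    forall p, U p ->
    nabla X (fun q => Y q + Y' q) p = nabla X Y p + nabla X Y' p;
  connection_leibniz : forall (f : V -> R^o) X Y,
    smooth U f -> smooth U X -> smooth U Y ->
    forall p, U p ->
    nabla X (fun q => f q *: Y q) p =
      'D_(X p) f p *: Y p + f p *: nabla X Y p }.

Definition torsion_free U
    (nabla : vector_field -> vector_field -> vector_field) : Prop :=
  forall X Y, smooth U X -> smooth U Y ->
  forall p, U p -> nabla X Y p - nabla Y X p = lie_bracket X Y p.

Definition metric_compatible U g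
    (nabla : vector_field -> vector_field -> vector_field) : Prop :=
  forall X Y Z, smooth U X -> smooth U Y -> smooth U Z ->
  forall p, U p ->
  'D_(X p) (fun q => g q (Y q) (Z q) : R^o) p =
    g p (nabla X Y p) (Z p) + g p (Y p) (nabla X Z p).

Definition levi_civita_connection U g
    (nabla : vector_field -> vector_field -> vector_field) : Prop :=
  [/\ affine_connection U nabla, torsion_free U nabla &
      metric_compatible U g nabla].

Definition curvature
    (nabla : vector_field -> vector_field -> vector_field) X Y Z
    : vector_field :=
  fun p => nabla X (nabla Y Z) p - nabla Y (nabla X Z) p
           - nabla (lie_bracket X Y) Z p.

(* "The" Levi-Civita connection is unique on U (not on total functions), hence
   the quantification.  It is universal so that the negation of [flat] asserts
   the existence of a Levi-Civita connection with nonzero curvature. *)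
Definition flat U g : Prop :=
  forall nabla, levi_civita_connection U g nabla ->
  forall X Y Z, smooth U X -> smooth U Y -> smooth U Z ->
  forall p, U p -> curvature nabla X Y Z p = 0.

End SemiRiemannian.

Arguments vector_field R : clear implicits.
Arguments tensor02 R : clear implicits.

Section GL2.
Context {R : realType}.

Definition GL2_pos : set 'M[R]_2 := [set M | 0 < \det M].

Definition left_invariant (g : tensor02 R) : Prop :=
  forall a, GL2_pos a -> isometry_of GL2_pos g (fun p => a *m p).

Definition right_invariant (g : tensor02 R) : Prop :=
  forall a, GL2_pos a -> isometry_of GL2_pos g (fun p => p *m a).

End GL2.

(* Main.v *)
Require Import Defs.
From HB Require Import structures.
From mathcomp Require Import all_boot all_order all_algebra.
From mathcomp Require Import ring lra.
From mathcomp Require Import all_classical all_reals all_analysis.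
Set Implicit Arguments.
Unset Strict Implicit.
Unset Printing Implicit Defensive.
Import Order.TTheory GRing.Theory Num.Theory.
Import numFieldNormedType.Exports.
Local Open Scope classical_set_scope.
Local Open Scope ring_scope.

(** Write [B] for the value of an invariant metric at the identity and [dot]
    for the product on gl2 such that the covariant derivative of the invariant
    field of [b] along the invariant field of [a] is the invariant field of
    [dot a b].  The Koszul formula gives [dot a b - dot b a] = [a, b] and makes
    each [dot a] skew for [B]; when the curvature vanishes, [a |-> dot a] is a
    representation of gl2.

    Such a product cannot exist, by the mechanism of the first Whitehead lemma:
    the identity of sl2 is a cocycle for this representation, which the Casimir
    operator turns into a coboundary [a |-> dot a u].  Let [C] be the Casimir operator of the
    sl2-triple (h, e, f) in the representation, and let [u] be the vector
    obtained by letting the Casimir element act on the cocycle.  The cocycle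
    identity gives [C x = dot x u] for [x] in sl2, and also for the central
    element [z], because [z] commutes with sl2 ([casimir_eq]).  Now [C] is
    self-adjoint for [B], so [B (C u) x = B u (dot x u) = 0] by skewness; hence
    [C u = 0] by nondegeneracy, and [C (C x) = dot x (C u) = 0]
    ([casimir_square]).  But a representation of sl2 whose Casimir operator
    squares to zero is trivial ([casimir_square0]): on the image of the last
    nonzero power [E ^+ m] of the raising operator, the Casimir operator is the
    scalar [m ^ 2 + 2 m], so [m = 0] and [E = 0].  Then [H = 0] as well, and
    [2 e = [h, e] = dot h e - dot e h = 0], which is absurd.

    As flatness quantifies over all Levi-Civita connections, one has to be
    exhibited.  It is the Euclidean derivative plus the tensor [christoffel],
    which corrects it so that the invariant fields are related by [dot]
    ([levi_civita_invariant_connection]); its smoothness rests on that of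
    matrix inversion ([smooth_invmx]).  Left and right invariance are treated
    at once: right translations are the left translations of the opposite
    algebra ([translate]). *)

(** * Representations of sl2 with nilpotent Casimir operator *)

Section Sl2.
Context {R : realType} {n : nat}.
Implicit Types A B h e f : 'M[R]_n.+1.

Lemma normmx_mul A B : `|A *m B| <= n.+1%:R * (`|A| * `|B|).
Proof.
rewrite [leLHS]/Num.Def.normr/= mx_normrE bigmax_le// => -[i j] _ /=.
rewrite mxE (le_trans (ler_norm_sum _ _ _))//.
have entry (M : 'M[R]_n.+1) k l : `|M k l| <= `|M|.
  by rewrite [leRHS]/Num.Def.normr/= mx_normrE; exact: (le_bigmax _ _ (k, l)).
have -> : n.+1%:R * (`|A| * `|B|) = \sum_(k < n.+1) `|A| * `|B|.
  by rewrite sumr_const card_ord mulr_natl.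
apply: ler_sum => k _.
by rewrite normrM ler_pM.
Qed.

Lemma commutator_eigen_exp h e k :
  h * e - e * h = 2 *: e -> h * e ^+ k - e ^+ k * h = (2 * k)%:R *: e ^+ k.
Proof.
move=> he; elim: k => [|k IH].
  by rewrite !expr0 mulr1 mul1r subrr scale0r.
have -> : h * e ^+ k.+1 - e ^+ k.+1 * h =
    (h * e - e * h) * e ^+ k + e * (h * e ^+ k - e ^+ k * h).
  by rewrite mulrBl mulrBr exprS !mulrA subrKA.
by rewrite he IH -scalerAl -scalerAr -exprS -scalerDl mulnS natrD.
Qed.

(** The powers of [e] are eigenvectors of the bounded operator
    [X |-> h * X - X * h] for the eigenvalues [2 * k], which are unbounded, so
    they cannot all be nonzero. *)
Lemma commutator_eigen_nilpotent h e :
  h * e - e * h = 2 *: e -> exists k, e ^+ k = 0.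
Proof.
move=> he; have [k hk] : exists k : nat, n.+1%:R * `|h| < k%:R.
  by exists (Num.trunc (n.+1%:R * `|h|)).+1; exact: truncnS_gt.
exists k; apply/eqP; rewrite -normr_eq0 eq_le normr_ge0 andbT.
rewrite leNgt; apply/negP => ek.
have le1 : `|h * e ^+ k| <= n.+1%:R * (`|h| * `|e ^+ k|) := normmx_mul _ _.
have le2 : `|e ^+ k * h| <= n.+1%:R * (`|e ^+ k| * `|h|) := normmx_mul _ _.
have := ler_normB (h * e ^+ k) (e ^+ k * h).
rewrite (commutator_eigen_exp k he) normrZ normr_nat natrM.
have : n.+1%:R * `|h| * `|e ^+ k| < k%:R * `|e ^+ k| by rewrite ltr_pM2r.
lra.
Qed.

(** Twice the usual Casimir element [h ^ 2 / 2 + e f + f e]. *)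
Definition casimir h e f := h * h + 2 *: (e * f + f * e).

(** The image of the last nonzero power [e ^+ m] consists of vectors of weight
    [m] killed by [e].  There the Casimir operator is the scalar
    [m ^ 2 + 2 * m], which is nilpotent only if [m = 0]. *)
Lemma casimir_square0 h e f :
  h * e - e * h = 2 *: e -> e * f - f * e = h ->
  casimir h e f * casimir h e f = 0 -> e = 0.
Proof.
move=> he ef C2; have [k0 nil] := commutator_eigen_nilpotent he.
have [m /andP[/eqP em1 emN]] : exists m, (e ^+ m.+1 == 0) && (e ^+ m != 0).
  elim: k0 nil => [/eqP|k IH nil]; first by rewrite expr0 oner_eq0.
  have [/IH//|ek] := eqVneq (e ^+ k) 0.
  by exists k; apply/andP; split=> //; exact/eqP.
(* For k = m the left-hand side vanishes, so h acts on e ^+ m as m. *)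
have raise k : e ^+ k.+1 * f - f * e ^+ k.+1 =
    k.+1%:R *: (h * e ^+ k - k%:R *: e ^+ k).
  elim: k => [|k IH].
    by rewrite expr1 ef expr0 scale1r mulr1 scale0r subr0.
  have -> : e ^+ k.+2 * f - f * e ^+ k.+2 =
      e * (e ^+ k.+1 * f - f * e ^+ k.+1) + (e * f - f * e) * e ^+ k.+1.
    by rewrite mulrBl mulrBr [e ^+ k.+2]exprS !mulrA subrKA.
  have eh : e * (h * e ^+ k) = h * e ^+ k.+1 - 2 *: e ^+ k.+1.
    by rewrite mulrA exprS scalerAl -he mulrBl !mulrA subKr.
  rewrite IH ef -scalerAr mulrBr -scalerAr eh -exprS.
  have combine (X Y : 'M[R]_n.+1) :
      k.+1%:R *: (X - 2 *: Y - k%:R *: Y) + X = k.+2%:R *: (X - k.+1%:R *: Y).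
    apply/matrixP => i j.
    by rewrite !mxE -[k.+2%:R]natr1 -[k.+1%:R]natr1; ring.
  exact: combine.
have hem : h * e ^+ m = m%:R *: e ^+ m.
  have := raise m; rewrite em1 mul0r mulr0 subrr => /esym/eqP.
  by rewrite scaler_eq0 pnatr_eq0/= subr_eq0 => /eqP.
have Cem : casimir h e f * e ^+ m = (m%:R ^+ 2 + 2 * m%:R) *: e ^+ m.
  rewrite /casimir (_ : e * f = h + f * e); last by rewrite -ef subrK.
  rewrite mulrDl -scalerAl 2!mulrDl -!mulrA hem -scalerAr hem -exprS em1.
  rewrite mulr0 !addr0.
  by rewrite !scalerA -scalerDl expr2.
have : casimir h e f * casimir h e f * e ^+ m = 0 by rewrite C2 mul0r.
rewrite -mulrA Cem -scalerAr Cem scalerA => /eqP.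
rewrite scaler_eq0 (negPf emN) orbF mulf_eq0 orbb => /eqP m0.
have {}m0 : m = 0%N.
  apply/eqP; rewrite -(eqr_nat R); have : (0:R) <= m%:R := ler0n _ _.
  by move: (m%:R : R) m0 => x; nra.
by move: em1; rewrite m0 expr1.
Qed.
End Sl2.

(** * Bilinear maps *)

Definition bilinear_map (R : pzRingType) (U V W : lmodType R)
  (b : U -> V -> W) := (forall y, linear (b^~ y)) /\ (forall x, linear (b x)).

Section BilinearMap.
Context {R : pzRingType} {U V W : lmodType R} {b : U -> V -> W}.
Context (bb : bilinear_map b).

Definition bilin_right x : {linear V -> W} :=
  HB.pack (b x) (GRing.isLinear.Build _ _ _ _ (b x) (bb.2 x)).
Definition bilin_left y : {linear U -> W} :=
  HB.pack (b^~ y) (GRing.isLinear.Build _ _ _ _ (b^~ y) (bb.1 y)).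

Lemma bilinDl x x' y : b (x + x') y = b x y + b x' y.
Proof. exact: (linearD (bilin_left y)). Qed.
Lemma bilinBl x x' y : b (x - x') y = b x y - b x' y.
Proof. exact: (linearB (bilin_left y)). Qed.
Lemma bilinNl x y : b (- x) y = - b x y.
Proof. exact: (linearN (bilin_left y)). Qed.
Lemma bilinZl a x y : b (a *: x) y = a *: b x y.
Proof. exact: (linearZ_LR (bilin_left y)). Qed.
Lemma bilin0l y : b 0 y = 0.
Proof. exact: (linear0 (bilin_left y)). Qed.
Lemma bilinDr x y y' : b x (y + y') = b x y + b x y'.
Proof. exact: (linearD (bilin_right x)). Qed.
Lemma bilinBr x y y' : b x (y - y') = b x y - b x y'.
Proof. exact: (linearB (bilin_right x)). Qed.
Lemma bilinNr x y : b x (- y) = - b x y.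
Proof. exact: (linearN (bilin_right x)). Qed.
Lemma bilinZr a x y : b x (a *: y) = a *: b x y.
Proof. exact: (linearZ_LR (bilin_right x)). Qed.
Lemma bilin0r x : b x 0 = 0.
Proof. exact: (linear0 (bilin_right x)). Qed.
Lemma bilin_suml I (r : seq I) (P : pred I) (F : I -> U) y :
  b (\sum_(i <- r | P i) F i) y = \sum_(i <- r | P i) b (F i) y.
Proof. exact: (linear_sum (bilin_left y)). Qed.
Lemma bilin_sumr I (r : seq I) (P : pred I) (F : I -> V) x :
  b x (\sum_(i <- r | P i) F i) = \sum_(i <- r | P i) b x (F i).
Proof. exact: (linear_sum (bilin_right x)). Qed.
End BilinearMap.

Lemma mulmx_mxvec_inj (R : pzRingType) m n p (M N : 'M[R]_(m * n, p)) :
  (forall A, mxvec A *m M = mxvec A *m N) -> M = N.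
Proof.
move=> MN; apply/row_matrixP => i.
by rewrite !rowE -[delta_mx 0 i]vec_mxK.
Qed.

(** * Flat skew products on gl2 *)

Section FlatProduct.
Context {R : realType}.
Local Notation V := 'M[R]_2.
Context (B : V -> V -> R^o) (dot : V -> V -> V).
Context (Bbil : bilinear_map B).
Context (Bsym : forall x y, B x y = B y x).
Context (Bnondeg : forall x, (forall y, B x y = 0) -> x = 0).
Context (dotbil : bilinear_map dot).
Local Notation "x · y" := (dot x y) (at level 40, left associativity).
Context (dot_skew : forall a b c, B (a · b) c = - B b (a · c)).
Context (dot_flat : forall a b c,
  a · (b · c) - b · (a · c) = (a · b - b · a) · c).
Context (h e f z : V).
Context (dot_he : h · e - e · h = 2 *: e).
Context (dot_hf : h · f - f · h = - 2 *: f).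
Context (dot_ef : e · f - f · e = h).
Context (dot_zh : z · h = h · z).
Context (dot_ze : z · e = e · z).
Context (dot_zf : z · f = f · z).
Context (span : forall x, exists a b c d,
  x = a *: h + b *: e + c *: f + d *: z).

(* C is the Casimir operator of the representation a |-> dot a, and u is its
   value on the cocycle id : sl2 -> V. *)
Local Notation C x := (h · (h · x) + 2 *: (e · (f · x) + f · (e · x))).
Local Notation u := (h · h + 2 *: (e · f + f · e)).

Lemma act_he x : h · (e · x) = e · (h · x) + 2 *: (e · x).
Proof. by rewrite -bilinZl// -dot_he -dot_flat addrC subrK. Qed.
Lemma act_hf x : h · (f · x) = f · (h · x) - 2 *: (f · x).
Proof. by rewrite -scaleNr -bilinZl// -dot_hf -dot_flat addrC subrK. Qed.
Lemma act_ef x : e · (f · x) = f · (e · x) + h · x.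
Proof. by rewrite -dot_ef -dot_flat addrC subrK. Qed.
Lemma act_zs s x : z · s = s · z -> z · (s · x) = s · (z · x).
Proof. by move=> zs; apply/subr0_eq; rewrite dot_flat zs subrr bilin0l. Qed.

Let bE := (bilinDr dotbil, bilinBr dotbil, bilinZr dotbil,
  bilinNr dotbil, bilinDl dotbil, bilinBl dotbil, bilinZl dotbil).

(** For a cocycle [d] with values in a representation of sl2, the Casimir
    element satisfies [C (d x) = x (sum_i e_i (d e^i))]; here [d] is the
    identity, whose cocycle identity is [dot a b - dot b a = [a, b]].  The
    central [z] obeys the same relation since [dot z s = dot s z]. *)
Lemma casimir_eq x : C x = x · u.
Proof.
have he : h · e = e · h + 2 *: e by rewrite -dot_he addrC subrK.
have hf : h · f = f · h - 2 *: f by rewrite -scaleNr -dot_hf addrC subrK.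
have ef : e · f = f · e + h by rewrite -dot_ef addrC subrK.
have [ka [kb [kc [kd ->]]]] := span x.
have Ch : C h = h · u.
  rewrite !bE !(act_he, act_hf) he hf !bE.
  by apply/matrixP => i j; rewrite !mxE; ring.
have Ce : C e = e · u.
  have fe y : f · (e · y) = e · (f · y) - h · y by rewrite act_ef addrK.
  rewrite ef fe he !bE act_he he.
  by apply/matrixP => i j; rewrite !mxE; ring.
have Cf : C f = f · u.
  rewrite hf ef !bE act_hf act_ef hf ef !bE.
  by apply/matrixP => i j; rewrite !mxE; ring.
have Cz : C z = z · u.
  by rewrite !bE !act_zs// ?dot_ze ?dot_zf ?dot_zh.
transitivity (ka *: C h + kb *: C e + kc *: C f + kd *: C z); last first.
  by rewrite Ch Ce Cf Cz !(bilinDl dotbil) !(bilinZl dotbil).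
rewrite !bE; apply/matrixP => i j; rewrite !mxE; ring.
Qed.

Lemma casimir_selfadjoint x y : B (C x) y = B x (C y).
Proof.
by rewrite !(bilinDl Bbil, bilinZl Bbil, bilinDr Bbil, bilinZr Bbil) !dot_skew
  !opprK [B x _ + B x (f · _)]addrC.
Qed.

(** [B (C u) x = B u (C x) = B u (dot x u)], and this vanishes because [dot x]
    is skew. *)
Lemma casimir_u : C u = 0.
Proof.
apply: Bnondeg => x; rewrite casimir_selfadjoint casimir_eq.
have := dot_skew x u u; rewrite Bsym; lra.
Qed.

(** [C] commutes with the action of [h], [e], [f] and [z], so that
    [C (C x) = C (dot x u) = dot x (C u) = 0]. *)
Lemma casimir_square x : C (C x) = 0.
Proof.
have fe y : f · (e · y) = e · (f · y) - h · y by rewrite act_ef addrK.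
have eh y : e · (h · y) = h · (e · y) - 2 *: (e · y) by rewrite act_he addrK.
have fh y : f · (h · y) = h · (f · y) + 2 *: (f · y) by rewrite act_hf subrK.
have Ch y : C (h · y) = h · C y.
  rewrite !fh !eh !bE !fh !eh.
  by apply/matrixP => i j; rewrite !mxE; ring.
have Ce y : C (e · y) = e · C y.
  rewrite (fe (e · y)) (act_ef y) !bE !act_he !bE !act_he.
  by apply/matrixP => i j; rewrite !mxE; ring.
have Cf y : C (f · y) = f · C y.
  rewrite (act_ef (f · y)) (fe y) !bE !act_hf !bE !act_hf.
  by apply/matrixP => i j; rewrite !mxE; ring.
have Cz y : C (z · y) = z · C y by rewrite !bE !act_zs.
have [a [b [c [d ->]]]] := span x.
transitivity (a *: C (C h) + b *: C (C e) + c *: C (C f) + d *: C (C z)).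
  rewrite !bE; apply/matrixP => i j; rewrite !mxE; ring.
have C0 s : (forall y, C (s · y) = s · C y) -> C (C s) = 0.
  by move=> Cs; rewrite [C s]casimir_eq Cs casimir_u bilin0r.
by rewrite !C0// !scaler0 !addr0.
Qed.

(** The representation is trivial on sl2, hence [dot h e - dot e h] is both
    [0] and [2 *: e]. *)
Lemma flat_product_sl2_eq0 : e = 0.
Proof.
(* Matrices act on row vectors, so composition is reversed; the sign turns
   a |-> lin_mx (dot a) back into a representation. *)
pose rho x : 'M[R]_(2 * 2) := - lin_mx (dot x).
have rhoE x A : mxvec A *m rho x = - mxvec (x · A).
  by rewrite mulmxN (mul_vec_lin (bilin_right dotbil x)).
have rho_he : rho h * rho e - rho e * rho h = 2 *: rho e.
  apply: mulmx_mxvec_inj => A.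
  rewrite mulmxBr !mulmxA -scalemxAr !rhoE !mulNmx !rhoE !opprK.
  by rewrite act_he linearD linearZ opprD addrA subrr sub0r scalerN.
have rho_ef : rho e * rho f - rho f * rho e = rho h.
  apply: mulmx_mxvec_inj => A.
  rewrite mulmxBr !mulmxA !rhoE !mulNmx !rhoE !opprK.
  by rewrite act_ef linearD opprD addrA subrr sub0r.
pose K : 'M[R]_(2 * 2) := casimir (rho h) (rho e) (rho f).
have rhoC (A : V) : mxvec A *m K = mxvec (C A).
  rewrite /K /casimir mulmxDr -scalemxAr mulmxDr !mulmxA !rhoE !mulNmx.
  rewrite !rhoE !opprK.
  by rewrite [e · _ + _]addrC !linearD /= !linearZ.
have K2 : K *m K = 0.
  apply: mulmx_mxvec_inj => A.
  by rewrite mulmxA !rhoC casimir_square linear0 mulmx0.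
have rho_e : rho e = 0 := casimir_square0 rho_he rho_ef K2.
have e0 A : e · A = 0.
  have := rhoE e A; rewrite rho_e mulmx0 => /eqP; rewrite eq_sym oppr_eq0.
  by rewrite mxvec_eq0 => /eqP.
have h0 A : h · A = 0.
  by have := act_ef A; rewrite !e0 bilin0r// add0r.
have := dot_he; rewrite h0 e0 subrr => /esym/eqP.
by rewrite scaler_eq0 pnatr_eq0/= => /eqP.
Qed.
End FlatProduct.

(** * Derivatives of bilinear expressions *)

Section Calculus.
Context {R : realType}.
Implicit Types V W : normedModType R.

Lemma differentiable_near_eq V W (f g : V -> W) (p : V) :
  {near p, f =1 g} -> differentiable f p -> differentiable g p.
Proof.
move=> fg df; have [dc fE] := (diff_locallyP p f).1 df.
have gE : g \o shift p = cst (g p) + 'd f p +o_ 0 id.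
  apply/eqaddoP => _/posnumP[eps].
  have /eqaddoP/(_ eps%:num) := fE; move=> /(_ (gt0 _)) fE'.
  have fg0 : \forall h \near (0 : V), f (h + p) = g (h + p).
    by move: fg; rewrite (near_shift 0 p) subr0.
  near=> h; rewrite -(nbhs_singleton fg).
  rewrite (_ : _ h = (f \o shift p - (cst (f p) + 'd f p)) h); first by near: h.
  by congr (_ - _); apply/esym; near: h.
have [dgE] := (diff_unique dc gE).
by apply/diff_locallyP; rewrite dgE.
Unshelve. all: by end_near. Qed.

(** In finite dimension, a bilinear map is a polynomial in the entries. *)
Lemma bilinear_mx_continuous m n k l (W : normedModType R)
    (b : 'M[R]_(m, n) -> 'M[R]_(k, l) -> W) :
  bilinear_map b -> continuous (fun p => b p.1 p.2).
Proof.
move=> bb.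
have -> : (fun p => b p.1 p.2) = (fun p : 'M[R]_(m, n) * 'M[R]_(k, l) =>
    \sum_i \sum_j \sum_s \sum_t
      (p.1 i j * p.2 s t) *: b (delta_mx i j) (delta_mx s t)).
  apply/funext => -[A A']; rewrite [in LHS](matrix_sum_delta A)/=.
  rewrite (bilin_suml bb); apply: eq_bigr => i _.
  rewrite (bilin_suml bb); apply: eq_bigr => j _.
  rewrite [in LHS](matrix_sum_delta A')/=.
  rewrite (bilin_sumr bb); apply: eq_bigr => s _.
  rewrite (bilin_sumr bb); apply: eq_bigr => t _.
  by rewrite bilinZl// bilinZr// scalerA.
have sumc (I : finType) (F : I -> 'M[R]_(m, n) * 'M[R]_(k, l) -> W) :
    (forall i, continuous (F i)) -> continuous (fun p => \sum_i F i p).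
  by move=> Fc; apply: continuous_big => //; exact: add_continuous.
apply: (sumc) => i; apply: (sumc) => j.
apply: (sumc) => s; apply: (sumc) => t p.
apply: cvgZr_tmp; apply: cvgM.
- apply: (continuous_comp (f := fst) (g := fun A : 'M[R]_(m, n) => A i j)).
    exact: cvg_fst.
  exact: coord_continuous.
- apply: (continuous_comp (f := snd) (g := fun A : 'M[R]_(k, l) => A s t)).
    exact: cvg_snd.
  exact: coord_continuous.
Qed.

Lemma bilinear_scale W : bilinear_map ( *:%R : R^o -> W -> W).
Proof.
split=> [y a x x'|x a y y']; first by rewrite scalerDl scalerA.
by rewrite scalerDr !scalerA mulrC.
Qed.

Lemma bilinear_mulmx m n p : bilinear_map (@mulmx R m n p).
Proof.
split=> [y a x x'|x a y y'].
  by rewrite mulmxDl scalemxAl.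
by rewrite mulmxDr scalemxAr.
Qed.

Section Bilinear.
Context {V U1 U2 W : normedModType R} {b : U1 -> U2 -> W}.
Context (bb : bilinear_map b) (bc : continuous (fun p => b p.1 p.2)).
Implicit Types (f : V -> U1) (g : V -> U2).

Lemma diff_bilinear f g p : differentiable f p -> differentiable g p ->
  is_diff p (fun q => b (f q) (g q))
            (fun v => b ('d f p v) (g p) + b (f p) ('d g p v)).
Proof.
move=> df dg.
pose bM := bilinear_isBilinear.Build R U1 U2 W *:%R *:%R b bb.
pose bL : {bilinear U1 -> U2 -> W} := HB.pack b bM.
have dfg := differentiable_pair df dg.
have db : differentiable (fun q : U1 * U2 => bL q.1 q.2) (f p, g p).
  exact: differentiable_bilin.
split; first exact: (differentiable_comp dfg db).
rewrite (diff_comp dfg db) (diff_bilin (f := bL) _ bc) diff_pair//.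
by apply/funext => v /=; rewrite addrC.
Qed.

Lemma differentiable_bilinear f g p : differentiable f p ->
  differentiable g p -> differentiable (fun q => b (f q) (g q)) p.
Proof. by move=> df dg; have [] := diff_bilinear df dg. Qed.

Lemma derive_bilinear f g p v : differentiable f p -> differentiable g p ->
  'D_v (fun q => b (f q) (g q)) p = b ('D_v f p) (g p) + b (f p) ('D_v g p).
Proof.
move=> df dg; have [d dE] := diff_bilinear df dg.
by rewrite !deriveE// dE.
Qed.
End Bilinear.

(** * Closure properties of smooth maps *)

Section Upto.
Context {V : normedModType R} {U : set V} (Uo : open U).

Lemma near_open (P : V -> Prop) p : U p -> (forall q, U q -> P q) ->
  \forall q \near p, P q.
Proof. by move=> Up UP; apply: (filterS UP); exact: open_nbhs_nbhs. Qed.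

Lemma differentiable_upto_eq W k (f g : V -> W) :
  (forall p, U p -> f p = g p) ->
  differentiable_upto k U f -> differentiable_upto k U g.
Proof.
elim: k f g => [//|k IH] f g fg [df Df]; split=> [p Up|v].
  by apply: differentiable_near_eq (df p Up); exact: near_open.
apply: IH (Df v) => p Up; apply: near_eq_derive; exact: near_open.
Qed.

Lemma differentiable_upto_le W k (f : V -> W) :
  differentiable_upto k.+1 U f -> differentiable_upto k U f.
Proof.
elim: k f => [//|k IH] f [df Df]; split=> // v; exact: IH (Df v).
Qed.

Lemma differentiable_upto_cst W k (c : W) : differentiable_upto k U (cst c).
Proof.
elim: k c => [//|k IH] c; split=> // v.
by apply: differentiable_upto_eq (IH 0) => p _; rewrite derive_cst.
Qed.

Lemma differentiable_uptoD W k (f g : V -> W) : differentiable_upto k U f ->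
  differentiable_upto k U g -> differentiable_upto k U (fun p => f p + g p).
Proof.
elim: k f g => [//|k IH] f g [df Df] [dg Dg]; split=> [p Up|v].
  by apply: differentiableD; [exact: df|exact: dg].
apply: differentiable_upto_eq (IH _ _ (Df v) (Dg v)) => p Up.
by rewrite deriveD//; apply: diff_derivable; [exact: df|exact: dg].
Qed.

Lemma differentiable_upto_bilinear (U1 U2 W : normedModType R)
    (b : U1 -> U2 -> W) k (f : V -> U1) (g : V -> U2) :
  bilinear_map b -> continuous (fun p => b p.1 p.2) ->
  differentiable_upto k U f -> differentiable_upto k U g ->
  differentiable_upto k U (fun p => b (f p) (g p)).
Proof.
move=> bb bc; elim: k f g => [//|k IH] f g df dg.
have [df' Df] := df; have [dg' Dg] := dg; split=> [p Up|v].
  by apply: differentiable_bilinear => //; [exact: df'|exact: dg'].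
have := differentiable_uptoD
  (IH _ _ (Df v) (differentiable_upto_le dg))
  (IH _ _ (differentiable_upto_le df) (Dg v)).
apply: differentiable_upto_eq => p Up.
by rewrite (derive_bilinear bb bc)//; [exact: df'|exact: dg'].
Qed.

End Upto.
End Calculus.

Section Smooth.
Context {R : realType} {V : normedModType R} {U : set V} (Uo : open U).
Implicit Types W : normedModType R.

Lemma smooth_differentiable W (f : V -> W) p :
  smooth U f -> U p -> differentiable f p.
Proof. by move=> /(_ 1)[df _]; exact: df. Qed.

Lemma smooth_derive W (f : V -> W) v :
  smooth U f -> smooth U (fun p => 'D_v f p).
Proof. by move=> sf k; have [_ Df] := sf k.+1; exact: Df. Qed.

Lemma smooth_eq W (f g : V -> W) :
  (forall p, U p -> f p = g p) -> smooth U f -> smooth U g.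
Proof. by move=> fg sf k; exact: differentiable_upto_eq (sf k). Qed.

Lemma smooth_cst W (c : W) : smooth U (fun=> c).
Proof. by move=> k; exact: differentiable_upto_cst. Qed.

Lemma smooth_id : smooth U id.
Proof.
case=> [//|k]; split=> [p _|v]; first exact: ex_diff.
apply: differentiable_upto_eq (smooth_cst v k) => // p _.
by rewrite derive_id.
Qed.

Lemma smoothD W (f g : V -> W) :
  smooth U f -> smooth U g -> smooth U (fun p => f p + g p).
Proof. by move=> sf sg k; exact: differentiable_uptoD. Qed.

Lemma smooth_sum W (I : finType) (f : I -> V -> W) :
  (forall i, smooth U (f i)) -> smooth U (fun p => \sum_i f i p).
Proof.
move=> sf; elim: (index_enum I) => [|i s IH].
  by under eq_fun do rewrite big_nil; exact: smooth_cst.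
by under eq_fun do rewrite big_cons; exact: smoothD.
Qed.

Lemma smoothZ W (f : V -> R^o) (g : V -> W) :
  smooth U f -> smooth U g -> smooth U (fun p => f p *: g p).
Proof.
move=> sf sg k.
apply: (differentiable_upto_bilinear (b := *:%R : R^o -> W -> W)
  Uo _ _ (sf k) (sg k)).
  exact: bilinear_scale.
exact: scale_continuous.
Qed.

Lemma smoothN W (f : V -> W) : smooth U f -> smooth U (fun p => - f p).
Proof.
move=> sf; under eq_fun do rewrite -scaleN1r.
exact: smoothZ (smooth_cst (-1 : R^o)) sf.
Qed.

Lemma smooth_bilinear_mx m n k l W (b : 'M[R]_(m, n) -> 'M[R]_(k, l) -> W)
    (f : V -> 'M[R]_(m, n)) (g : V -> 'M[R]_(k, l)) :
  bilinear_map b -> smooth U f -> smooth U g ->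
  smooth U (fun p => b (f p) (g p)).
Proof.
move=> bb sf sg r; apply: (differentiable_upto_bilinear Uo bb _ (sf r) (sg r)).
exact: bilinear_mx_continuous.
Qed.

Lemma derive_bilinear_mx m n k l W (b : 'M[R]_(m, n) -> 'M[R]_(k, l) -> W)
    (f : V -> 'M[R]_(m, n)) (g : V -> 'M[R]_(k, l)) p v :
  bilinear_map b -> differentiable f p -> differentiable g p ->
  'D_v (fun q => b (f q) (g q)) p = b ('D_v f p) (g p) + b (f p) ('D_v g p).
Proof. by move=> bb; exact/derive_bilinear/bilinear_mx_continuous. Qed.

Lemma differentiable_bilinear_mx m n k l W
    (b : 'M[R]_(m, n) -> 'M[R]_(k, l) -> W)
    (f : V -> 'M[R]_(m, n)) (g : V -> 'M[R]_(k, l)) p :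
  bilinear_map b -> differentiable f p -> differentiable g p ->
  differentiable (fun q => b (f q) (g q)) p.
Proof. by move=> bb; exact/differentiable_bilinear/bilinear_mx_continuous. Qed.

(** The entry map is the bilinear map [A, B |-> (A *m B) i j] at [A = 1]. *)
Lemma smooth_entry m n (f : V -> 'M[R]_(m, n)) i j :
  smooth U f -> smooth U (fun p => f p i j : R^o).
Proof.
move=> sf; pose b (A : 'M[R]_m) (B : 'M[R]_(m, n)) : R^o := (A *m B) i j.
have bb : bilinear_map b.
  split=> [B a A A'|A a B B']; rewrite /b.
    by rewrite mulmxDl -scalemxAl !mxE.
  by rewrite mulmxDr -scalemxAr !mxE.
apply: smooth_eq (smooth_bilinear_mx bb (smooth_cst 1%:M) sf) => p _.
by rewrite /b mul1mx.
Qed.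
End Smooth.

Lemma derive_linear (R : realType) (V W : normedModType R) (f : V -> W) p :
  differentiable f p -> linear (fun v => 'D_v f p).
Proof. by move=> df a x y; rewrite !deriveE// linearP. Qed.

Lemma derive_delta (R : realType) m n (W : normedModType R)
    (f : 'M[R]_(m, n) -> W) p v : differentiable f p ->
  'D_v f p = \sum_i \sum_j v i j *: 'D_(delta_mx i j) f p.
Proof.
move=> df; rewrite deriveE// [in LHS](matrix_sum_delta v) linear_sum.
apply: eq_bigr => i _; rewrite linear_sum; apply: eq_bigr => j _.
by rewrite linearZ deriveE.
Qed.

(** The derivative along [X] is a combination, with the entries of [X] as
    coefficients, of the derivatives along constant directions. *)
Lemma smooth_directional (R : realType) m n (U : set 'M[R]_(m, n))
    (W : normedModType R) (X : 'M[R]_(m, n) -> 'M[R]_(m, n))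
    (f : 'M[R]_(m, n) -> W) :
  open U -> smooth U X -> smooth U f -> smooth U (fun p => 'D_(X p) f p).
Proof.
move=> Uo sX sf.
apply: (smooth_eq Uo
  (f := fun p => \sum_i \sum_j X p i j *: 'D_(delta_mx i j) f p)).
  by move=> p Up; rewrite [RHS]derive_delta//; exact: smooth_differentiable Up.
do 2!(apply: smooth_sum => // ?); apply: smoothZ => //.
  exact: smooth_entry.
exact: smooth_derive.
Qed.

(** * Smoothness of matrix inversion *)

Section Inverse.
Context {R : realType}.
Local Notation V := 'M[R]_2.
Local Notation U := (@GL2_pos R).

Lemma ord2P (k : 'I_2) : k = 0 \/ k = 1.
Proof. by case: k => [[|[|//]] lt]; [left|right]; exact/val_inj. Qed.

Lemma det_mx22 (q : V) : \det q = q 0 0 * q 1 1 - q 0 1 * q 1 0.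
Proof.
rewrite (expand_det_row _ 0) !big_ord_recl big_ord0 /cofactor !det_mx11 !mxE/=.
have -> : lift ord0 ord0 = 1 :> 'I_2 by exact/val_inj.
have -> : lift 1 0 = 0 :> 'I_2 by exact/val_inj.
by rewrite expr0 /= expr1; ring.
Qed.

Lemma GL2_pos_unit q : U q -> q \in unitmx.
Proof. by rewrite /GL2_pos/= unitmxE unitfE => /gt_eqF ->. Qed.

Lemma GL2_pos1 : U 1%:M.
Proof. by rewrite /GL2_pos/= det1. Qed.

Lemma GL2_posV q : U q -> U (invmx q).
Proof. by rewrite /GL2_pos/= det_inv invr_gt0. Qed.

(** By Cayley-Hamilton, [q * (tr q - q) = det q].  This makes the inverse an
    explicit function of the entries. *)
Lemma invmx22 (q : V) : q \in unitmx ->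
  invmx q = (\det q)^-1 *: ((q 0 0 + q 1 1)%:M - q).
Proof.
move=> qu; apply: (can_inj (mulKmx qu)); rewrite mulmxV// -scalemxAr.
apply/esym.
have -> : q *m ((q 0 0 + q 1 1)%:M - q) = (\det q)%:M.
  rewrite det_mx22; apply/matrixP => i j.
  rewrite !mxE !big_ord_recl big_ord0 !mxE.
  have -> : lift ord0 ord0 = 1 :> 'I_2 by exact/val_inj.
  case: (ord2P i) => ->; case: (ord2P j) => ->;
    by rewrite /= ?mulr1n ?mulr0n; ring.
rewrite scale_scalar_mx mulVf//.
by rewrite -unitfE -unitmxE.

Qed.

Lemma differentiable_det (p : V) : differentiable (fun q : V => \det q : R^o) p.
Proof.
under eq_fun do rewrite det_mx22.
have dc := @differentiable_coord R 2 2 p.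
apply: differentiableB; apply: differentiableM; exact: dc.
Qed.

Lemma GL2_pos_open : open U.
Proof.
have -> : U = (fun q : V => \det q : R^o) @^-1` [set x | 0 < x] by [].
apply: open_comp; last exact: open_gt.
move=> p _; exact/differentiable_continuous/differentiable_det.
Qed.

Lemma differentiable_invmx p : U p -> differentiable (@invmx R 2) p.
Proof.
move=> Up.
apply: (differentiable_near_eq
  (f := fun q => (\det q)^-1 *: ((q 0 0 + q 1 1) *: 1%:M - q))).
  apply: (near_open GL2_pos_open Up) => q Uq.
  by rewrite invmx22 ?GL2_pos_unit// scalemx1.
apply: (differentiable_bilinear (b := *:%R : R^o -> V -> V)).
- exact: bilinear_scale.
- exact: scale_continuous.
- apply: (differentiableV (f := fun q : V => \det q : R^o)).
    exact: differentiable_det.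
  by move: Up; rewrite /GL2_pos/= => /gt_eqF ->.
- apply: differentiableB; last exact: ex_diff.
  apply: (differentiable_bilinear (b := *:%R : R^o -> V -> V)).
  + exact: bilinear_scale.
  + exact: scale_continuous.
  + apply: differentiableD; exact: differentiable_coord.
  + exact: differentiable_cst.
Qed.

Lemma derive_invmx p v : U p ->
  'D_v (@invmx R 2) p = - (invmx p *m v *m invmx p).
Proof.
move=> Up; have pu := GL2_pos_unit Up; have dV := differentiable_invmx Up.
have : 'D_v (fun q : V => q *m invmx q) p = 0.
  rewrite -(derive_cst (1%:M : V) p v); apply: near_eq_derive.
  by apply: (near_open GL2_pos_open Up) => q Uq; rewrite mulmxV ?GL2_pos_unit.
rewrite (derive_bilinear_mx _ (@bilinear_mulmx R 2 2 2))// derive_id => /eqP.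
rewrite addrC addr_eq0 => /eqP /(congr1 (mulmx (invmx p))).
by rewrite mulKmx// mulmxN mulmxA.
Qed.

(** The derivative of the inverse is a product of inverses and a constant, so
    one more derivative exists at each step. *)
Lemma smooth_invmx : smooth U (@invmx R 2).
Proof.
have Uo := GL2_pos_open.
elim=> [//|k IH]; split=> [p|v]; first exact: differentiable_invmx.
apply: (differentiable_upto_eq Uo
  (f := fun p => - 1%:M *m (invmx p *m v *m invmx p))).
  by move=> p Up; rewrite derive_invmx// mulNmx mul1mx.
have bb := @bilinear_mulmx R 2 2 2; have bc := bilinear_mx_continuous bb.
do ?[apply: (differentiable_upto_bilinear Uo bb bc)];
  do ?[exact: differentiable_upto_cst]; exact: IH.
Qed.
End Inverse.

(** * The Koszul product of a nondegenerate form *)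

Section Koszul.
Context {R : realType} {m n : nat}.
Local Notation V := 'M[R]_(m, n).
Context {B : V -> V -> R^o}.
Context (Bbil : bilinear_map B) (Bsym : forall x y, B x y = B y x)
  (Bnondeg : forall x, (forall y, B x y = 0) -> x = 0).

Lemma nondegenerate_inj x x' : (forall y, B x y = B x' y) -> x = x'.
Proof.
move=> E; apply/subr0_eq/Bnondeg => y.
by rewrite (bilinBl Bbil) E subrr.
Qed.

(** Nondegeneracy says that the Gram matrix has trivial kernel, hence is
    invertible; its inverse produces the representing vector. *)
Lemma nondegenerate_represents (F : V -> R^o) :
  linear F -> exists x, forall y, B x y = F y.
Proof.
move=> Flin; pose FM := GRing.isLinear.Build _ _ _ _ F Flin.
pose FL : {linear V -> R^o} := HB.pack F FM.
have FZ a x : F (a *: x) = a * F x by exact: (linearZ_LR FL).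
have Fsum (G : 'I_(m * n) -> V) : F (\sum_k G k) = \sum_k F (G k).
  exact: (linear_sum FL).
pose gram := \matrix_(i, j) B (vec_mx (delta_mx 0 i)) (vec_mx (delta_mx 0 j)).
have gramE (u v : 'rV_(m * n)) :
    (u *m gram *m v^T) 0 0 = B (vec_mx u) (vec_mx v).
  rewrite [u in RHS]row_sum_delta [v in RHS]row_sum_delta !linear_sum.
  rewrite (bilin_sumr Bbil) mxE; apply: eq_bigr => j _.
  rewrite (bilin_suml Bbil) !mxE mulr_suml; apply: eq_bigr => i _.
  rewrite !linearZ (bilinZl Bbil) (bilinZr Bbil) !mxE.
  by rewrite mulrAC -mulrA.
have gramU : gram \in unitmx.
  rewrite -row_free_unit; apply: inj_row_free => v vG.
  apply/eqP; rewrite -vec_mx_eq0; apply/eqP/Bnondeg => y.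
  by rewrite -[y]mxvecK -gramE vG mul0mx mxE.
exists (vec_mx (\row_k F (vec_mx (delta_mx 0 k)) *m invmx gram)) => y.
rewrite -[y]mxvecK -gramE mulmxKV// mxE.
rewrite [in RHS](row_sum_delta (mxvec y)) linear_sum Fsum.
by apply: eq_bigr => k _; rewrite linearZ FZ !mxE mulrC.
Qed.

(** The Koszul formula for fields with constant inner products:
    [2 B (dot a b) c = B [a, b] c - B [b, c] a + B [c, a] b]. *)
Lemma koszul_product (br : V -> V -> V) :
  bilinear_map br -> (forall a b, br b a = - br a b) ->
  exists dot : V -> V -> V,
    [/\ bilinear_map dot,
        forall a b, dot a b - dot b a = br a b &
        forall a b c, B (dot a b) c = - B b (dot a c)].
Proof.
move=> brbil br_anti.
pose K a b c : R := 2^-1 * (B (br a b) c - B (br b c) a + B (br c a) b).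
have Klin a b : linear (K a b : V -> R^o).
  move=> k x y; rewrite /K.
  rewrite !(bilinDl brbil, bilinZl brbil, bilinDr brbil, bilinZr brbil).
  rewrite !(bilinDl Bbil, bilinZl Bbil, bilinDr Bbil, bilinZr Bbil).
  rewrite /GRing.scale/=; ring.
have /choice[dot dotE] :
    forall ab : V * V, exists x, forall c, B x c = K ab.1 ab.2 c.
  by case=> a b; exact: nondegenerate_represents.
exists (fun a b => dot (a, b)).
have simp := (bilinDl brbil, bilinZl brbil, bilinDr brbil, bilinZr brbil,
  bilinDl Bbil, bilinZl Bbil, bilinNl Bbil, bilinDr Bbil, bilinZr Bbil).
split.
- split=> [b k a a'|a k b b']; apply: nondegenerate_inj => c;
    rewrite !simp !dotE /K/= !simp /GRing.scale/=; ring.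
- move=> a b; apply: nondegenerate_inj => c; rewrite !simp !dotE /K/=.
  rewrite (br_anti a b) (br_anti a c) (br_anti b c) !(bilinNl Bbil).
  by field.
- move=> a b c; rewrite [in RHS]Bsym !dotE /K/=.
  rewrite (br_anti a b) (br_anti a c) (br_anti b c) !(bilinNl Bbil).
  by ring.
Qed.
End Koszul.

(** * The Levi-Civita connection of an invariant metric *)

Section InvariantMetric.
Context {R : realType} (s : bool).
Local Notation V := 'M[R]_2.
Local Notation U := (@GL2_pos R).

(** Multiplication in the matrix algebra or, for [s] false, in its opposite.
    Both are associative with unit [1%:M] and inverse [invmx], and the
    geometry below is expressed through these operations only. *)
Definition translate (a x : V) : V := if s then a *m x else x *m a.
Local Notation "a ** x" := (translate a x) (at level 40, left associativity).
Local Notation I2 := (1%:M : V).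

Lemma bilinear_translate : bilinear_map translate.
Proof.
rewrite /translate; case: s; first exact: bilinear_mulmx.
by have [bl br] := @bilinear_mulmx R 2 2 2; split.
Qed.
Local Notation tbil := bilinear_translate.

Lemma translateA a b x : a ** (b ** x) = a ** b ** x.
Proof. by rewrite /translate; case: s; rewrite mulmxA. Qed.

Lemma translate1 x : I2 ** x = x.
Proof. by rewrite /translate; case: s; rewrite ?mul1mx ?mulmx1. Qed.

Lemma translateV p : U p -> p ** invmx p = I2.
Proof.
move=> /GL2_pos_unit pu.
by rewrite /translate; case: s; rewrite ?mulmxV ?mulVmx.
Qed.

Lemma translateVl p : U p -> invmx p ** p = I2.
Proof.
move=> /GL2_pos_unit pu.
by rewrite /translate; case: s; rewrite ?mulmxV ?mulVmx.
Qed.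

Lemma translateK p x : U p -> invmx p ** (p ** x) = x.
Proof. by move=> Up; rewrite translateA translateVl// translate1. Qed.

Lemma translateVK p x : U p -> p ** (invmx p ** x) = x.
Proof. by move=> Up; rewrite translateA translateV// translate1. Qed.

Lemma derive_inverse p v : U p ->
  'D_v (@invmx R 2) p = - (invmx p ** v ** invmx p).
Proof.
by move=> Up; rewrite derive_invmx// /translate; case: s; rewrite ?mulmxA.
Qed.

Lemma smooth_translate (X Y : V -> V) :
  smooth U X -> smooth U Y -> smooth U (fun p => X p ** Y p).
Proof. by apply: smooth_bilinear_mx; [exact: GL2_pos_open|exact: tbil]. Qed.

Lemma derive_translate (X Y : V -> V) p v :
  differentiable X p -> differentiable Y p ->
  'D_v (fun q => X q ** Y q) p = 'D_v X p ** Y p + X p ** 'D_v Y p.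
Proof. exact: derive_bilinear_mx tbil. Qed.

Lemma derive_translate_cst p v x : 'D_v (translate^~ x) p = v ** x.
Proof.
rewrite derive_translate// derive_id derive_cst (bilin0r tbil) addr0//.
Qed.

(** The Lie bracket of gl2 up to sign: for [s] false, it is the opposite one. *)
Definition bracket a b := a ** b - b ** a.

Lemma lie_bracket_translate a b p :
  lie_bracket (translate^~ a) (translate^~ b) p = p ** bracket a b.
Proof.
rewrite /lie_bracket !derive_translate_cst /bracket.
by rewrite (bilinBr tbil) !translateA.
Qed.

Section Connection.
Context (g : tensor02 R).
Context (g_bil : bilinear_map (g I2 : V -> V -> R^o)).
Context (g_inv : forall p x y, U p ->
  g p x y = g I2 (invmx p ** x) (invmx p ** y)).
Context (dot : V -> V -> V) (dot_bil : bilinear_map dot).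
Context (dot_bracket : forall a b, dot a b - dot b a = bracket a b).
Context (dot_skew : forall a b c, g I2 (dot a b) c = - g I2 b (dot a c)).

(** The first term is the transport of [dot] to the point [p]; the second one
    cancels the Euclidean derivative of the field [q ** (invmx p ** y)], which
    is the invariant field with value [y] at [p], in the direction [x]. *)
Definition christoffel p x y :=
  p ** dot (invmx p ** x) (invmx p ** y) - x ** (invmx p ** y).

Definition invariant_connection (X Y : V -> V) p :=
  'D_(X p) Y p + christoffel p (X p) (Y p).
Local Notation nabla := invariant_connection.

Lemma christoffel_bilinear p : bilinear_map (christoffel p).
Proof.
rewrite /christoffel; split=> [y a x x'|x a y y'];
  rewrite !(bilinDl tbil, bilinZl tbil, bilinDr tbil, bilinZr tbil,
    bilinDl dot_bil, bilinZl dot_bil, bilinDr dot_bil, bilinZr dot_bil);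
  by rewrite scalerBr opprD addrACA.
Qed.

(** Both terms of [christoffel] have the same antisymmetric part,
    [p ** bracket a b] for [x = p ** a] and [y = p ** b]. *)
Lemma christoffel_sym p x y : U p -> christoffel p x y = christoffel p y x.
Proof.
move=> Up; rewrite /christoffel; set a := invmx p ** x; set b := invmx p ** y.
have -> : dot a b = dot b a + bracket a b by rewrite -dot_bracket addrC subrK.
have mulE u v : p ** (invmx p ** u ** v) = u ** v.
  by rewrite translateA translateVK.
rewrite (bilinDr tbil) /bracket (bilinBr tbil) !mulE.
by rewrite addrA addrAC addrK.
Qed.

Lemma smooth_connection X Y :
  smooth U X -> smooth U Y -> smooth U (nabla X Y).
Proof.
move=> sX sY; have Uo := @GL2_pos_open R; have sV := @smooth_invmx R.
apply: smoothD => //; first exact: smooth_directional.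
apply: smoothD => //.
  apply: smooth_translate; first exact: smooth_id.
  by apply: smooth_bilinear_mx => //; exact: smooth_translate.
by apply: smoothN => //; apply: smooth_translate => //; exact: smooth_translate.
Qed.

Lemma affine_invariant_connection : affine_connection U nabla.
Proof.
have Uo := @GL2_pos_open R; have cb := christoffel_bilinear.
split.
- exact: smooth_connection.
- move=> X X' Y Y' _ _ _ _ eqX eqY p Up; rewrite /nabla eqX// eqY//.
  by congr (_ + _); apply: near_eq_derive; exact: (near_open Uo Up eqY).
- move=> X X' Y sX sX' sY p Up; have dY := smooth_differentiable sY Up.
  rewrite /nabla -[X p in LHS]scale1r (derive_linear dY) (bilinDl (cb p)).
  by rewrite !scale1r addrACA.
- move=> f X Y sf sX sY p Up; have dY := smooth_differentiable sY Up.
  rewrite /nabla -[f p *: X p]addr0 (derive_linear dY) derive0 !addr0.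
  by rewrite (bilinZl (cb p)) [RHS]scalerDr.
- move=> X Y Y' sX sY sY' p Up.
  have dY := smooth_differentiable sY Up.
  have dY' := smooth_differentiable sY' Up.
  rewrite /nabla deriveD ?(bilinDr (cb p)) 1?addrACA//; exact: diff_derivable.
- move=> f X Y sf sX sY p Up.
  have df := smooth_differentiable sf Up.
  have dY := smooth_differentiable sY Up.
  rewrite /nabla (derive_bilinear (b := *:%R : R^o -> V -> V))//.
  + by rewrite (bilinZr (cb p)) [f p *: (_ + _) in RHS]scalerDr addrA.
  + exact: bilinear_scale.
  + exact: scale_continuous.
Qed.

Lemma torsion_free_invariant_connection : torsion_free U nabla.
Proof.
move=> X Y sX sY p Up.
by rewrite /nabla /lie_bracket christoffel_sym// opprD addrACA subrr addr0.
Qed.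

(** The defect of [christoffel] in the invariant frame is [dot], whose
    skewness then gives compatibility with the metric. *)
Lemma derive_pullback (Y : V -> V) p v : smooth U Y -> U p ->
  'D_v (fun q => invmx q ** Y q) p =
  invmx p ** ('D_v Y p + christoffel p v (Y p))
    - dot (invmx p ** v) (invmx p ** Y p).
Proof.
move=> sY Up; have dY := smooth_differentiable sY Up.
rewrite derive_translate//; last exact: differentiable_invmx.
rewrite derive_inverse// /christoffel.
rewrite (bilinDr tbil) (bilinBr tbil) translateK//.
rewrite (bilinNl tbil) !translateA addrA addrAC addrAC [in RHS]addrAC addrK.
by rewrite addrC.
Qed.

Lemma metric_invariant_connection : metric_compatible U g nabla.
Proof.
move=> X Y Z sX sY sZ p Up; have Uo := @GL2_pos_open R.
have dP W : smooth U W -> differentiable (fun q => invmx q ** W q) p.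
  move=> sW; apply: (smooth_differentiable _ Up).
  by apply: smooth_translate => //; exact: smooth_invmx.
rewrite (near_eq_derive
  (g := fun q => g I2 (invmx q ** Y q) (invmx q ** Z q) : R^o)); last first.
  by apply: (near_open Uo Up) => q Uq; exact: g_inv.
rewrite (derive_bilinear_mx _ g_bil); [|exact: dP..].
rewrite !derive_pullback// !(g_inv _ _ Up).
rewrite (bilinBl g_bil) (bilinBr g_bil) dot_skew.
by rewrite opprK addrACA addrN addr0.
Qed.

Lemma levi_civita_invariant_connection : levi_civita_connection U g nabla.
Proof.
split; [exact: affine_invariant_connection|
  exact: torsion_free_invariant_connection|exact: metric_invariant_connection].
Qed.

Lemma invariant_connection_translate a b p : U p ->
  nabla (translate^~ a) (translate^~ b) p = p ** dot a b.
Proof.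
move=> Up; rewrite /nabla derive_translate_cst /christoffel !translateK//.
by rewrite addrC subrK.
Qed.

(** The curvature at the identity, evaluated on invariant fields, which the
    connection and the Lie bracket preserve. *)
Lemma flat_dot : flat U g -> forall a b c,
  dot a (dot b c) - dot b (dot a c) = dot (dot a b - dot b a) c.
Proof.
move=> fl a b c; rewrite dot_bracket.
have st x : smooth U (translate^~ x).
  apply: smooth_translate; first exact/smooth_id/GL2_pos_open.
  exact/smooth_cst/GL2_pos_open.
have U1 := @GL2_pos1 R.
have sn x y := smooth_connection (st x) (st y).
have lc := levi_civita_invariant_connection.
have [[_ loc _ _ _ _] _ _] := lc.
have iter x y : nabla (translate^~ x) (nabla (translate^~ y) (translate^~ c)) I2
    = dot x (dot y c).
  rewrite (loc _ (translate^~ x) _ (translate^~ (dot y c)))//.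
    by rewrite invariant_connection_translate// translate1.
  by move=> p Up; rewrite invariant_connection_translate.
have := fl _ lc _ _ _ (st a) (st b) (st c) _ U1.
rewrite /curvature !iter.
have -> : lie_bracket (translate^~ a) (translate^~ b)
    = translate^~ (bracket a b).
  by apply/funext => p; rewrite lie_bracket_translate.
by rewrite invariant_connection_translate// translate1 => /subr0_eq.
Qed.
End Connection.

(** * Invariant metrics on GL2 are not flat *)

Lemma bracket1 a : bracket I2 a = 0.
Proof.
by rewrite /bracket /translate; case: s; rewrite mulmx1 mul1mx subrr.
Qed.

Lemma bracket_bilinear : bilinear_map bracket.
Proof.
rewrite /bracket; split=> [y a x x'|x a y y'];
  by rewrite (bilinDl tbil) (bilinZl tbil) (bilinDr tbil) (bilinZr tbil)
     scalerBr opprD addrACA.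
Qed.

Lemma gl2_basis : exists h e f : V,
  [/\ bracket h e = 2 *: e, bracket h f = - 2 *: f, bracket e f = h, e != 0 &
      forall x, exists a b c d, x = a *: h + b *: e + c *: f + d *: I2].
Proof.
(* Passing to the opposite bracket exchanges the roles of e and f. *)
pose i : 'I_2 := if s then 0 else 1; pose j : 'I_2 := if s then 1 else 0.
have mulD (k l k' l' : 'I_2) : (delta_mx k l : V) *m delta_mx k' l' =
    delta_mx k l' *+ (l == k') by exact: mul_delta_mx_cond.
exists (delta_mx 0 0 - delta_mx 1 1), (delta_mx i j), (delta_mx j i); split.
- rewrite /bracket /translate /i /j; case: s;
    rewrite !(mulmxBl, mulmxBr, mulD)/= ?mulr0n ?mulr1n;
    by rewrite !subr0 sub0r opprK scaler_nat mulr2n.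
- rewrite /bracket /translate /i /j; case: s;
    rewrite !(mulmxBl, mulmxBr, mulD)/= ?mulr0n ?mulr1n;
    by rewrite !sub0r subr0 -opprD scaleNr scaler_nat mulr2n.
- rewrite /bracket /translate /i /j; case: s;
    by rewrite !mulD/= ?mulr1n.
- by apply/eqP => /matrixP/(_ i j)/eqP; rewrite !mxE !eqxx/= oner_eq0.
- move=> x.
  exists ((x 0 0 - x 1 1) / 2), (x i j), (x j i), ((x 0 0 + x 1 1) / 2).
  apply/matrixP => k l; rewrite !mxE /i /j.
  by case: s; case: (ord2P k) => ->; case: (ord2P l) => -> /=; field.
Qed.

(** Translation by [invmx p] is a linear isometry that takes [p] to the
    identity. *)
Lemma invariant_metricE (g : tensor02 R) :
  (forall a, U a -> isometry_of U g (translate a)) ->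
  forall p x y, U p -> g p x y = g I2 (invmx p ** x) (invmx p ** y).
Proof.
move=> iso p x y Up; have [_ /(_ _ Up x y) <-] := iso _ (GL2_posV Up).
have dT v : 'd (translate (invmx p)) p v = invmx p ** v.
  rewrite -deriveE; last first.
    by apply: (differentiable_bilinear_mx tbil) => //; exact: ex_diff.
  rewrite (derive_bilinear_mx _ tbil)// derive_cst derive_id.
  by rewrite (bilin0l tbil) add0r.
by rewrite /pullback !dT translateVl.
Qed.

Lemma invariant_metric_not_flat (g : tensor02 R) :
  semi_riemannian_metric U g ->
  (forall a, U a -> isometry_of U g (translate a)) -> ~ flat U g.
Proof.
move=> [bil _ sym nondeg _] iso fl; have U1 := @GL2_pos1 R.
have g_bil : bilinear_map (g I2 : V -> V -> R^o).
  have [bl br] := bil _ U1.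
  by split=> [y a x x'|x a y y']; [exact: bl|exact: br].
have br_anti a b : bracket b a = - bracket a b by rewrite /bracket opprB.
have [dot [dot_bil dot_br dot_skew]] :=
  koszul_product g_bil (sym _ U1) (nondeg _ U1) bracket_bilinear br_anti.
have dot_flat :=
  flat_dot g_bil (invariant_metricE iso) dot_bil dot_br dot_skew fl.
have [h [e [f [he hf ef /eqP e_neq0 span]]]] := gl2_basis.
apply: e_neq0; apply: (flat_product_sl2_eq0 g_bil (sym _ U1) (nondeg _ U1)
  dot_bil dot_skew dot_flat (h := h) (f := f) (z := I2)) => //;
  by [rewrite dot_br|apply/subr0_eq; rewrite dot_br bracket1].
Qed.
End InvariantMetric.

Theorem proposition1 (R : realType) :
  (forall g : tensor02 R, semi_riemannian_metric GL2_pos g ->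
     left_invariant g -> ~ flat GL2_pos g) /\
  (forall g : tensor02 R, semi_riemannian_metric GL2_pos g ->
     right_invariant g -> ~ flat GL2_pos g).
Proof.
split=> g gm inv.
- exact: (@invariant_metric_not_flat R true).
- exact: (@invariant_metric_not_flat R false).
Qed.
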